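(* Let $A,B,C\in\mathbb{F}^{m\times m}$ and let $f:\mathbb{F}^{m\times m}\to\mathbb{F}^{m\times m}$ be a period-$2$, general linear matrix operator that is multiplication preserving or multiplication reversing. Consider the equation $AX+f(X)B=C$ in the unknown $X\in\mathbb{F}^{m\times m}$. (a) Suppose $f$ is multiplication preserving. If $\sigma(Af(A))\cap\sigma(Bf(B))=\emptyset$, then the equation $AX+f(X)B=C$ has a unique solution $X\in\mathbb{F}^{m\times m}$. (b) Suppose $f$ is multiplication reversing. If the two matrix pencils $A-\lambda f(B)$ and $B-\lambda f(A)$ are regular and $\sigma(A-\lambda f(B))\cap\sigma(B-\lambda f(A))=\emptyset$, then the equation $AX+f(X)B=C$ has a unique solution $X\in\mathbb{F}^{m\times m}$.
   Context: $\mathbb{F}$ is $\mathbb{R}$ or $\mathbb{C}$, and $m\ge 1$. The operator $f:\mathbb{F}^{m\times m}\to\mathbb{F}^{m\times m}$ is: - period-$2$ if $f(f(M))=M$ for all $M$; - multiplication preserving if $f(MN)=f(M)f(N)$ for all $M,N$; - multiplication reversing if $f(MN)=f(N)f(M)$ for all $M,N$; - general linear if $f(M+N)=f(M)+f(N)$ for all $M,N$ and there is an injective function $s:\mathbb{F}\to\mathbb{F}$ with $f(aM)=s(a)f(M)$ for all $a\in\mathbb{F}$ and all $M$. A matrix pencil $D-\lambda E$ with $D,E\in\mathbb{F}^{m\times m}$ is regular if $\det(D-\lambda E)\neq 0$ for some $\lambda\in\mathbb{F}$. For a square matrix $M$, $\sigma(M)\subset\mathbb{C}$ is its set of (complex)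 eigenvalues. For a pencil, $\sigma(D-\lambda E)\subset\mathbb{C}\cup\{\infty\}$ is its set of generalized eigenvalues: it consists of all $\lambda\in\mathbb{C}$ with $\det(D-\lambda E)=0$, together with $\infty$ if $\det E=0$. *)

(* Defs.v *)
From HB Require Import structures.
From mathcomp Require Import all_boot all_order all_algebra.
From mathcomp Require Import complex.
From mathcomp Require Import boolp classical_sets reals.

Set Implicit Arguments.
Unset Strict Implicit.
Unset Printing Implicit Defensive.

Import GRing.Theory Num.Theory.
Local Open Scope ring_scope.
Local Open Scope complex_scope.
Local Open Scope classical_set_scope.

(* [real_or_complex iota]: the scalar field F is R or C = R[i], and
   [iota : F -> C] is its standard embedding, used to take spectra in C. *)
Inductive real_or_complex (R : realType) :
    forall F : fieldType, {rmorphism F -> R[i]} -> Prop :=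
| RealScalars : @real_or_complex R R (real_complex R)
| ComplexScalars : @real_or_complex R R[i] idfun.

Section MatrixOperators.
Variables (F : fieldType) (m : nat).
Implicit Type f : 'M[F]_m -> 'M[F]_m.

Definition period2 f : Prop := forall M, f (f M) = M.

Definition mul_preserving f : Prop :=
  forall M N, f (M *m N) = f M *m f N.

Definition mul_reversing f : Prop :=
  forall M N, f (M *m N) = f N *m f M.

Definition general_linear f : Prop :=
  (forall M N, f (M + N) = f M + f N) /\
  (exists s : F -> F, injective s /\ forall a M, f (a *: M) = s a *: f M).

Definition regular_pencil (D E : 'M[F]_m) : Prop :=
  exists lambda : F, \det (D - lambda *: E) != 0.

End MatrixOperators.

Section Spectra.
Variables (R : realType) (F : fieldType) (iota : {rmorphism F -> R[i]}).
Variable m : nat.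

Definition spectrum (M : 'M[F]_m) : set R[i] :=
  [set lambda | eigenvalue (map_mx iota M) lambda].

(* Spectrum of the pencil D - lambda E in the extended plane [option R[i]],
   where [None] stands for the point at infinity. *)
Definition pencil_spectrum (D E : 'M[F]_m) : set (option R[i]) :=
  [set z | match z with
           | Some lambda => \det (map_mx iota D - lambda *: map_mx iota E) = 0
           | None => \det E = 0
           end].

End Spectra.

(* Main.v *)
(* Pairing the equation with its image under f turns it into an F-linear system
   in the two unknowns X and Y = f X.  If that system has trivial kernel it has a
   unique solution (X, Y), and since (f Y, f X) is again a solution, Y = f X.
   The kernel is computed over the algebraically closed field R[i]: there the
   system reduces to a Sylvester equation P Z = Z Q.  In the preserving case
   P = A f(A) and Q = B f(B); in the reversing case, with D = f(B) and E = f(A),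
   P = D (A - mu D)^-1 and Q = E (B - mu E)^-1, where mu is a common regular
   point of both pencils. *)
Require Import Defs.
From HB Require Import structures.
From mathcomp Require Import all_boot all_order all_algebra.
From mathcomp Require Import complex.
From mathcomp Require Import boolp classical_sets reals.

Set Implicit Arguments.
Unset Strict Implicit.
Unset Printing Implicit Defensive.

Import GRing.Theory Num.Theory.
Local Open Scope ring_scope.
Local Open Scope complex_scope.
Local Open Scope classical_set_scope.

Lemma eigenvalue_det (K : fieldType) n (M : 'M[K]_n) (a : K) :
  eigenvalue M a = (\det (M - a%:M) == 0).
Proof.
by rewrite /eigenvalue /eigenspace kermx_eq0 row_free_unit unitmxE unitfE negbK.
Qed.

(** Since p(P) X = X p(Q) for every polynomial p, a Bezout relation between the coprime
    characteristic polynomials, evaluated at P, gives X = v(P) X q(Q) with q that of Q, and q(Q) = 0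
    by Cayley-Hamilton. *)
Lemma sylvester_eq0 (K : closedFieldType) n (P Q X : 'M[K]_n) :
  (forall a, eigenvalue P a -> eigenvalue Q a -> False) ->
  P *m X = X *m Q -> X = 0.
Proof.
case: n P Q X => [|n] P Q X PQ PX; first exact: flatmx0.
have hX p : horner_mx P p *m X = X *m horner_mx Q p.
  elim/poly_ind: p => [|p c IHp]; first by rewrite !rmorph0 mul0mx mulmx0.
  rewrite !rmorphD !rmorphM /= !horner_mx_X !horner_mx_C mulmxDl mulmxDr.
  by rewrite -!mulmxE -mulmxA PX !mulmxA IHp scalar_mxC.
have : coprimep (char_poly P) (char_poly Q).
  apply/Pdiv.ClosedField.coprimepP => a.
  rewrite -(eigenvalue_root_char P) => Pa; apply/negP => Qa.
  by apply: PQ Pa _; rewrite eigenvalue_root_char.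
case/Bezout_eq1_coprimepP => -[u v] /= uv1.
have := congr1 (horner_mx P) uv1.
rewrite rmorphD !rmorphM rmorph1 /= Cayley_Hamilton mulr0 add0r => vQ1.
by rewrite -[X]mul1mx -[1%:M]vQ1 -mulmxE -mulmxA hX Cayley_Hamilton !mulmx0.
Qed.

Lemma coupled_eq0 (K : closedFieldType) n (A A' B B' X Y : 'M[K]_n) :
  (forall a, eigenvalue (A *m A') a -> eigenvalue (B *m B') a -> False) ->
  A *m X + Y *m B = 0 -> A' *m Y + X *m B' = 0 -> X = 0 /\ Y = 0.
Proof.
move=> AB eqA eqA'.
have AX : A *m X = - (Y *m B) by apply/eqP; rewrite -addr_eq0 eqA.
have A'Y : A' *m Y = - (X *m B') by apply/eqP; rewrite -addr_eq0 eqA'.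
have Y0 : Y = 0.
  (* Multiplying the second equation by [A] on the left eliminates [X]: A A' Y = - A X B' = Y B
     B'. *)
  apply: sylvester_eq0 AB _.
  by rewrite -mulmxA A'Y mulmxN (mulmxA A) AX mulNmx opprK mulmxA.
split=> //; move: AX A'Y; rewrite Y0 mul0mx mulmx0 oppr0 => AX /eqP.
rewrite eq_sym oppr_eq0 => /eqP XB'.
(* 0 cannot be an eigenvalue of both products, so A or B' is invertible. *)
have [dA|dA] := eqVneq (\det A) 0; last first.
  have uA : A \in unitmx by rewrite unitmxE unitfE.
  by rewrite -[X](mulKmx uA) AX mulmx0.
have [dB|dB] := eqVneq (\det B') 0; last first.
  have uB : B' \in unitmx by rewrite unitmxE unitfE.
  by rewrite -[X](mulmxK uB) XB' mul0mx.
by case: (AB 0); rewrite eigenvalue_det raddf0 subr0 det_mulmx ?dA ?dB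
  ?mul0r ?mulr0.
Qed.

Lemma det_pencil_poly (K : comNzRingType) n (D E : 'M[K]_n) :
  exists p : {poly K}, forall a, p.[a] = \det (D - a *: E).
Proof.
exists (\det (map_mx polyC D - 'X *: map_mx polyC E)) => a.
rewrite -[LHS]/(horner_eval a _) -det_map_mx; congr (\det _).
by apply/matrixP => i j; rewrite !mxE /= /horner_eval !hornerE.
Qed.

(** Both determinants are nonzero polynomials in the parameter, so their product has a non-root. *)
Lemma common_regular_point (K : closedFieldType) n (A B D E : 'M[K]_n) :
  regular_pencil A D -> regular_pencil B E ->
  exists a, \det (A - a *: D) != 0 /\ \det (B - a *: E) != 0.
Proof.
have [p pE] := det_pencil_poly A D; have [q qE] := det_pencil_poly B E.
move=> [a pa] [b qb]; rewrite -pE in pa; rewrite -qE in qb.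
have pq0 : p * q != 0.
  rewrite mulf_neq0 //; first by apply: contraNneq pa => ->; rewrite horner0.
  by apply: contraNneq qb => ->; rewrite horner0.
have [c] := closed_nonrootP _ pq0.
by rewrite rootM negb_or => /andP[pc qc]; exists c; rewrite -pE -qE.
Qed.

(* An eigenvalue v of D (A - mu D)^-1 corresponds to the generalized eigenvalue
   mu + 1/v of the pencil A - lambda D, with v = 0 corresponding to infinity. *)
Lemma pencil_eigenvalue (K : fieldType) n (A D : 'M[K]_n) (mu v : K) :
  \det (A - mu *: D) != 0 ->
  eigenvalue (D *m invmx (A - mu *: D)) v ->
  if v == 0 then \det D = 0 else \det (A - (mu + v^-1) *: D) = 0.
Proof.
move=> dP; set P := A - mu *: D in dP *.
have uP : P \in unitmx by rewrite unitmxE unitfE.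
rewrite eigenvalue_det => /eqP dv.
have {dv} : \det (D - v *: P) = 0.
  have -> : D - v *: P = (D *m invmx P - v%:M) *m P.
    by rewrite mulmxBl mulmxKV // mul_scalar_mx.
  by rewrite det_mulmx dv mul0r.
have [->|v0 dv] := eqVneq v 0; first by rewrite scale0r subr0.
have -> : A - (mu + v^-1) *: D = - v^-1 *: (D - v *: P).
  rewrite scalerBr scalerA mulNr mulVf // scaleN1r opprK scalerDl scaleNr.
  by rewrite /P opprD addrA addrC.
by rewrite detZ dv mulr0.
Qed.

Lemma generalized_sylvester_eq0 (K : closedFieldType) n
    (A B D E X Y : 'M[K]_n) :
  regular_pencil A D -> regular_pencil B E ->
  (forall a, \det (A - a *: D) = 0 -> \det (B - a *: E) = 0 -> False) ->
  (\det D = 0 -> \det E = 0 -> False) ->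
  A *m X + Y *m B = 0 -> D *m X + Y *m E = 0 -> X = 0 /\ Y = 0.
Proof.
move=> regA regB fin_disj inf_disj eqA eqD.
have [mu [dP dQ]] := common_regular_point regA regB.
have PX : (A - mu *: D) *m X = - (Y *m (B - mu *: E)).
  apply/eqP; rewrite -addr_eq0 mulmxBl mulmxBr -scalemxAl -scalemxAr.
  by rewrite addrACA -opprD -scalerDr eqA eqD scaler0 subr0.
have DX : D *m X = - (Y *m E) by apply/eqP; rewrite -addr_eq0 eqD.
have sp a : eigenvalue (D *m invmx (A - mu *: D)) a ->
    eigenvalue (E *m invmx (B - mu *: E)) a -> False.
  move=> /(pencil_eigenvalue dP) + /(pencil_eigenvalue dQ).
  (* A common eigenvalue [a] would give both pencils the generalized eigenvalue infinity if a = 0,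
     and mu + 1/a otherwise. *)
  by case: eqP => _; [exact: inf_disj | exact: fin_disj].
have uP : A - mu *: D \in unitmx by rewrite unitmxE unitfE.
have uQ : B - mu *: E \in unitmx by rewrite unitmxE unitfE.
have XE : X = - (invmx (A - mu *: D) *m Y *m (B - mu *: E)).
  by rewrite -[LHS](mulKmx uP) PX mulmxN mulmxA.
have Y0 : Y = 0.
  (* Multiplying on the right by [B - mu *: E] clears one inverse; what remains is D X = - Y E with
     [XE] substituted. *)
  apply: sylvester_eq0 sp _; apply: (can_inj (mulmxK uQ)).
  rewrite -!mulmxA mulVmx // mulmx1; apply: oppr_inj.
  by rewrite -DX XE mulmxN !mulmxA.
by split=> //; rewrite XE Y0 mulmx0 mul0mx oppr0.
Qed.

Lemma linear_inj_surj (F : fieldType) (V : vectType F) (L : {linear V -> V}) :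
  (forall x, L x = 0 -> x = 0) -> forall y, exists x, L x = y.
Proof.
move=> L0 y; have kerL : lker (linfun L) == 0%VS.
  rewrite -subv0; apply/subvP => x; rewrite memv_ker lfunE memv0 => /eqP /L0 ->.
  exact: eqxx.
by exists ((linfun L)^-1%VF y); rewrite -[L _]lfunE lker0_lfunVK.
Qed.

Section Coupling.
Variables (F : fieldType) (V : vectType F) (g h g' h' : {linear V -> V}).

(** Treating f x as an independent unknown gives a map linear over [F] even when f is not, as for
    complex conjugation. *)
Definition coupling (z : V * V) : V * V :=
  (g z.1 + h z.2, g' z.2 + h' z.1).

Lemma coupling_is_linear : linear coupling.
Proof.
move=> a [x y] [x' y']; rewrite /coupling; apply/pair_equal_spec; split=> /=.
  by rewrite !linearP addrACA -scalerDr.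
by rewrite !linearP addrACA -scalerDr.
Qed.

HB.instance Definition _ :=
  GRing.isLinear.Build F (V * V)%type (V * V)%type _ coupling coupling_is_linear.

Lemma coupling_unique (f : V -> V) (c : V) :
  involutive f -> (forall x y, f (g x + h y) = g' (f x) + h' (f y)) ->
  (forall x y, g x + h y = 0 -> g' y + h' x = 0 -> x = 0 /\ y = 0) ->
  exists! x, g x + h (f x) = c.
Proof.
move=> fK fE ker0.
have cpl0 z : coupling z = 0 -> z = 0.
  by case: z => x y [/ker0 /[apply] -[-> ->]].
have cplI : injective coupling.
  by move=> z w zw; apply/eqP; rewrite -subr_eq0; apply/eqP/cpl0;
     rewrite linearB /= zw subrr.
have [[x y] xyE] := linear_inj_surj cpl0 (c, f c).
have [Ec Efc] : g x + h y = c /\ g' y + h' x = f c by case: xyE.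
(* Applying f exchanges the two equations, so the swapped pair solves the same system; injectivity
   forces y = f x. *)
have : coupling (f y, f x) = coupling (x, y).
  rewrite xyE /coupling /=; congr pair.
    by apply: (can_inj fK); rewrite fE !fK.
  by rewrite -fE Ec.
case/cplI => _ fx; exists x; split; first by rewrite fx.
move=> x' x'E; have : coupling (x, y) = coupling (x', f x').
  by rewrite xyE /coupling /= x'E -x'E fE fK.
by case/cplI.
Qed.

End Coupling.

Theorem theorem2p2 (R : realType) (F : fieldType) (iota : {rmorphism F -> R[i]})
    (F_RC : real_or_complex iota)
    (m : nat) (m_ge1 : (1 <= m)%N)
    (A B C : 'M[F]_m) (f : 'M[F]_m -> 'M[F]_m)
    (f_period2 : period2 f) (f_linear : general_linear f)
    (f_mul : mul_preserving f \/ mul_reversing f) :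
  (mul_preserving f ->
     spectrum iota (A *m f A) `&` spectrum iota (B *m f B) = set0 ->
     exists! X : 'M[F]_m, A *m X + f X *m B = C)
  /\
  (mul_reversing f ->
     regular_pencil A (f B) -> regular_pencil B (f A) ->
     pencil_spectrum iota A (f B) `&` pencil_spectrum iota B (f A) = set0 ->
     exists! X : 'M[F]_m, A *m X + f X *m B = C).
Proof.
have [fD _] := f_linear.
(* The kernel is tested after extension to [R[i]], where the spectra live; no information is lost,
   as [iota] is injective. *)
pose phi := map_mx iota : 'M[F]_m -> 'M[R[i]]_m.
have phi0 (X Y : 'M[F]_m) : phi X = 0 /\ phi Y = 0 -> X = 0 /\ Y = 0.
  by move=> [/eqP + /eqP]; rewrite !map_mx_eq0 => /eqP -> /eqP ->.
have lift (P Q S T : 'M[F]_m) :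
    P *m Q + S *m T = 0 -> phi P *m phi Q + phi S *m phi T = 0.
  by rewrite /phi -!map_mxM -map_mxD => ->; rewrite map_mx0.
split=> fM.
  move=> disj.
  apply: (@coupling_unique F 'M[F]_m (mulmx A) (mulmxr B)
            (mulmx (f A)) (mulmxr (f B)) f C) => // [X Y|X Y eqA eqA'] /=.
    by rewrite fD !fM.
  apply/phi0/(coupled_eq0 _ (lift _ _ _ _ eqA) (lift _ _ _ _ eqA')) => a.
  rewrite /phi -!map_mxM => Aa Ba.
  have : (spectrum iota (A *m f A) `&` spectrum iota (B *m f B)) a
    by exact (conj Aa Ba).
  by rewrite disj.
move=> regA regB disj.
have reg (D E : 'M[F]_m) : regular_pencil D E ->
    regular_pencil (phi D) (phi E).
  case=> a da; exists (iota a).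
  by rewrite /phi -map_mxZ -map_mxB det_map_mx fmorph_eq0.
(* Reversal exchanges sides: f(A X + Y B) = f(B) f(Y) + f(X) f(A). The second kernel equation is
   thus f(B) X + Y f(A) = 0, which pairs [A] with f(B) and [B] with f(A). *)
apply: (@coupling_unique F 'M[F]_m (mulmx A) (mulmxr B)
          (mulmxr (f A)) (mulmx (f B)) f C) => // [X Y|X Y eqA] /=.
  by rewrite fD !fM.
rewrite addrC => eqD.
apply/phi0/(generalized_sylvester_eq0 (reg _ _ regA) (reg _ _ regB) _ _
             (lift _ _ _ _ eqA) (lift _ _ _ _ eqD)) => [a dA dB|].
  have : (pencil_spectrum iota A (f B) `&` pencil_spectrum iota B (f A))
           (Some a) by exact (conj dA dB).
  by rewrite disj.
(* The point at infinity is defined by determinants over [F], so their vanishing is pulled back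
   along [iota]. *)
rewrite !det_map_mx => /eqP + /eqP; rewrite !fmorph_eq0 => /eqP dA /eqP dB.
have : (pencil_spectrum iota A (f B) `&` pencil_spectrum iota B (f A)) None
  by exact (conj dA dB).
by rewrite disj.
Qed.
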